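(* Let $A,B\in\mathbb{C}^{m\times n}$. The following statements are equivalent: (a) $A\leq^\diamond B$. (b) $A^\dagger=A^\dagger B A^\dagger$ and $A=BB^\dagger A=AB^\dagger B$. (c) $A^\dagger=A^\dagger B A^\dagger=A^\dagger B B^\dagger=B^\dagger B A^\dagger$.
   Context: $A^*$ is the conjugate transpose, $\mathcal{R}(\cdot)$ the range (column space), and $A^\dagger\in\mathbb{C}^{n\times m}$ the Moore-Penrose inverse of $A\in\mathbb{C}^{m\times n}$. The diamond partial order on $\mathbb{C}^{m\times n}$ is defined by: $A\leq^\diamond B$ iff $\mathcal{R}(A)\subseteq\mathcal{R}(B)$, $\mathcal{R}(A^* )\subseteq\mathcal{R}(B^* )$ and $AB^*A=AA^*A$. *)

(* Defs.v *)
From mathcomp Require Import all_boot all_order all_algebra.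
From mathcomp Require Import boolp classical_sets reals.

Set Implicit Arguments.
Unset Strict Implicit.
Unset Printing Implicit Defensive.

Import Order.TTheory GRing.Theory Num.Theory.
Local Open Scope ring_scope.
Local Open Scope classical_set_scope.
Local Open Scope sesquilinear_scope.

Section MoorePenrose.
Variable C : numClosedFieldType.

(* [A ^t*] is MathComp's conjugate transpose. *)
Lemma trCmx_mul m n p (A : 'M[C]_(m, n)) (B : 'M[C]_(n, p)) :
  (A *m B) ^t* = B ^t* *m A ^t*.
Proof. by rewrite trmx_mul map_mxM. Qed.

Lemma trCmxK m n (A : 'M[C]_(m, n)) : A ^t* ^t* = A.
Proof. by apply/matrixP=> i j; rewrite !mxE conjCK. Qed.

Definition penrose m n (A : 'M[C]_(m, n)) (X : 'M[C]_(n, m)) : bool :=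
  [&& A *m X *m A == A,
      X *m A *m X == X,
      (A *m X) ^t* == A *m X &
      (X *m A) ^t* == X *m A].

Lemma mul_trCmx_eq0 n (w : 'rV[C]_n) : w *m w ^t* = 0 -> w = 0.
Proof.
move=> /matrixP/(_ 0 0); rewrite !mxE => /eqP.
rewrite psumr_eq0 => [/allP w0|i _]; last by rewrite !mxE mul_conjC_ge0.
apply/rowP => i; rewrite mxE; apply/eqP.
by have := w0 i (mem_index_enum i); rewrite !mxE mul_conjC_eq0.
Qed.

Lemma gram_unitmx r n (G : 'M[C]_(r, n)) :
  row_free G -> G *m G ^t* \in unitmx.
Proof.
move=> Gfree; rewrite -row_free_unit; apply/row_freeP.
apply/row_freeP/inj_row_free => v vGG.
apply/(row_free_inj Gfree); rewrite mul0mx; apply/mul_trCmx_eq0.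
by rewrite trCmx_mul mulmxA -(mulmxA v) vGG mul0mx.
Qed.

Lemma trCmx_inv_herm n (H : 'M[C]_n) : H ^t* = H -> (invmx H) ^t* = invmx H.
Proof. by move=> HH; rewrite trmx_inv map_invmx HH. Qed.

Lemma penrose_exists m n (A : 'M[C]_(m, n)) : exists X, penrose A X.
Proof.
have Gfree : row_free (row_base A) := row_base_free A.
have Ffree : row_free ((col_base A) ^t*).
  rewrite /row_free mxrank_map mxrank_tr.
  by have := col_base_full A; rewrite /row_full.
have := gram_unitmx Ffree; have := gram_unitmx Gfree; rewrite trCmxK.
have := mulmx_base A.
move: {Gfree Ffree} (\rank A) (col_base A) (row_base A) => r F G AE uG uF.
set P := invmx (G *m G ^t*); set Q := invmx (F ^t* *m F).
have hP : P ^t* = P by apply: trCmx_inv_herm; rewrite trCmx_mul trCmxK.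
have hQ : Q ^t* = Q by apply: trCmx_inv_herm; rewrite trCmx_mul trCmxK.
pose X := G ^t* *m P *m (Q *m F ^t*).
have AX : A *m X = F *m Q *m F ^t*.
  by rewrite -AE /X !mulmxA -(mulmxA F G) mulmxK.
have XA : X *m A = G ^t* *m P *m G.
  by rewrite -AE /X !mulmxA -(mulmxA _ (F ^t*) F) mulmxKV.
exists X; apply/and4P; split; apply/eqP.
- by rewrite AX -AE mulmxA -(mulmxA _ (F ^t*) F) mulmxKV.
- by rewrite XA /X !mulmxA -(mulmxA _ G (G ^t*)) mulmxKV.
- by rewrite AX !trCmx_mul trCmxK hQ mulmxA.
- by rewrite XA !trCmx_mul trCmxK hP mulmxA.
Qed.

Lemma penrose_unique m n (A : 'M[C]_(m, n)) (X Y : 'M[C]_(n, m)) :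
  penrose A X -> penrose A Y -> X = Y.
Proof.
move=> /and4P[/eqP X1 /eqP X2 /eqP X3 /eqP X4].
move=> /and4P[/eqP Y1 /eqP Y2 /eqP Y3 /eqP Y4].
have AXY : A *m X = A *m Y.
  by rewrite -X3 -{1}Y1 -mulmxA trCmx_mul X3 Y3 !mulmxA X1.
have XYA : X *m A = Y *m A.
  by rewrite -X4 -{1}Y1 !mulmxA -(mulmxA (X *m A)) trCmx_mul X4 Y4
     -!mulmxA (mulmxA A X A) X1.
by rewrite -X2 XYA -mulmxA AXY mulmxA Y2.
Qed.

Definition mpinv m n (A : 'M[C]_(m, n)) : 'M[C]_(n, m) :=
  xchoose (penrose_exists A).

Lemma mpinvP m n (A : 'M[C]_(m, n)) : penrose A (mpinv A).
Proof. exact: xchooseP. Qed.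

(* The [<=] of [%MS] compares row spaces, so the column space is spelled out. *)
Definition mxrange m n (A : 'M[C]_(m, n)) : set 'cV[C]_m :=
  range (fun x : 'cV[C]_n => A *m x).

Definition diamond_le m n (A B : 'M[C]_(m, n)) : Prop :=
  [/\ mxrange A `<=` mxrange B,
      mxrange (A ^t*) `<=` mxrange (B ^t*) &
      A *m B ^t* *m A = A *m A ^t* *m A].

End MoorePenrose.

(* Main.v *)
Require Import Defs.
From mathcomp Require Import all_boot all_order all_algebra reals complex.
From mathcomp Require Import classical_sets.
Local Open Scope ring_scope.

(** Range inclusions become absorption identities for the projectors [B B^+]
    and [B^+ B].  Every condition on [A^+] then turns into the same condition on
    [A^*], because [A^+] and [A^*] are multiples of each other on both sides:
    [A^+ = A^+ (A^+)^* A^* = A^* (A^+)^* A^+] and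
    [A^* = A^* A A^+ = A^+ A A^*]. *)

Section DiamondOrder.
Local Open Scope sesquilinear_scope.
Local Open Scope classical_set_scope.
Variable C : numClosedFieldType.

Section Absorption.
Variables (m n : nat) (A : 'M[C]_(m, n)).
Let X := mpinv A.

Lemma mulmx_mpinvK : A *m X *m A = A.
Proof. by case/and4P: (mpinvP A) => /eqP. Qed.

Lemma mpinv_mulmxK : X *m A *m X = X.
Proof. by case/and4P: (mpinvP A) => _ /eqP. Qed.

Lemma mulmx_mpinv_herm : (A *m X) ^t* = A *m X.
Proof. by case/and4P: (mpinvP A) => _ _ /eqP. Qed.

Lemma mpinv_mulmx_herm : (X *m A) ^t* = X *m A.
Proof. by case/and4P: (mpinvP A) => _ _ _ /eqP. Qed.

Lemma mpinv_trCl : X *m X ^t* *m A ^t* = X.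
Proof. by rewrite -mulmxA -trCmx_mul mulmx_mpinv_herm mulmxA mpinv_mulmxK. Qed.

Lemma mpinv_trCr : A ^t* *m X ^t* *m X = X.
Proof. by rewrite -trCmx_mul mpinv_mulmx_herm mpinv_mulmxK. Qed.

Lemma trC_mpinvl : X *m A *m A ^t* = A ^t*.
Proof. by rewrite -mpinv_mulmx_herm -trCmx_mul mulmxA mulmx_mpinvK. Qed.

Lemma trC_mpinvr : A ^t* *m A *m X = A ^t*.
Proof. by rewrite -mulmxA -mulmx_mpinv_herm -trCmx_mul mulmx_mpinvK. Qed.

(** Since [P] is Hermitian, the left side is [A ^t* = A ^t* *m P] by adjunction. [X] has [A ^t*] as
    its last factor in [mpinv_trCl], and [A ^t*] has [X] as its last factor in [trC_mpinvr], so [P]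
    is absorbed by both or by neither. *)
Lemma mpinv_fixr (P : 'M[C]_m) : P ^t* = P -> A = P *m A <-> X = X *m P.
Proof.
move=> hP; split=> h.
  have hA : A ^t* *m P = A ^t* by rewrite -{1}hP -trCmx_mul -h.
  by rewrite -[in RHS]mpinv_trCl -mulmxA hA mpinv_trCl.
have hA : A ^t* = A ^t* *m P by rewrite -[in RHS]trC_mpinvr -mulmxA -h trC_mpinvr.
by rewrite -[LHS]trCmxK hA trCmx_mul hP trCmxK.
Qed.

Lemma mpinv_fixl (P : 'M[C]_n) : P ^t* = P -> A = A *m P <-> X = P *m X.
Proof.
move=> hP; split=> h.
  have hA : P *m A ^t* = A ^t* by rewrite -{1}hP -trCmx_mul -h.
  by rewrite -[in RHS]mpinv_trCr !mulmxA hA mpinv_trCr.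
have hA : A ^t* = P *m A ^t* by rewrite -[in RHS]trC_mpinvl !mulmxA -h trC_mpinvl.
by rewrite -[LHS]trCmxK hA trCmx_mul hP trCmxK.
Qed.

Lemma mpinv_outer (B : 'M[C]_(m, n)) :
  A *m B ^t* *m A = A *m A ^t* *m A <-> X = X *m B *m X.
Proof.
split=> h.
  have {}h : A ^t* *m B *m A ^t* = A ^t* *m A *m A ^t*.
    by have := congr1 (fun M => M ^t*) h; rewrite !trCmx_mul !trCmxK !mulmxA.
  (* Stated for all [M]: used at [B], then backwards at [A], where [X *m A *m X] collapses to
     [X]. *)
  have sandwich (M : 'M[C]_(m, n)) :
      X *m M *m X = X *m X ^t* *m (A ^t* *m M *m A ^t*) *m (X ^t* *m X).
    rewrite !mulmxA mpinv_trCl -!mulmxA; congr (_ *m (_ *m _)).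
    by rewrite mulmxA mpinv_trCr.
  by rewrite sandwich h -sandwich mpinv_mulmxK.
have {}h : A ^t* *m B *m A ^t* = A ^t* *m A *m A ^t*.
  rewrite -{1}trC_mpinvr -{2}trC_mpinvl.
  (* Expanding both outer copies of [A ^t*] brings an [X] to each side of [B], so that [h]
     applies. *)
  rewrite (_ : _ *m (X *m A *m _) = A ^t* *m A *m (X *m B *m X) *m A *m A ^t*).
    by rewrite -h trC_mpinvr.
  by rewrite !mulmxA.
by have := congr1 (fun M => M ^t*) h; rewrite !trCmx_mul !trCmxK !mulmxA.
Qed.

End Absorption.

Lemma mxrange_subP m n p (A : 'M[C]_(m, n)) (B : 'M[C]_(m, p)) :
  mxrange A `<=` mxrange B <-> exists D, A = B *m D.
Proof.
split=> [sAB | [D ->] _ [x _ <-]]; last by exists (D *m x); rewrite ?mulmxA.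
(* The boolean equality lets [xchoose] pick a preimage of each column; these preimages are the
   columns of [D]. *)
have colB j : exists x : 'cV_p, B *m x == col j A.
  have [|x _ Bx] := sAB (col j A); last by exists x; apply/eqP.
  by exists (delta_mx j 0); rewrite // colE.
exists (\matrix_(i, j) xchoose (colB j) i 0).
apply/matrixP=> i j; have /eqP/matrixP/(_ i 0) := xchooseP (colB j).
by rewrite !mxE => <-; apply: eq_bigr => k _; rewrite mxE.
Qed.

Lemma mxrange_sub_mpinv m n p (A : 'M[C]_(m, n)) (B : 'M[C]_(m, p)) :
  mxrange A `<=` mxrange B <-> A = B *m mpinv B *m A.
Proof.
split=> [/mxrange_subP[D ->] | h]; first by rewrite mulmxA mulmx_mpinvK.
by apply/mxrange_subP; exists (mpinv B *m A); rewrite mulmxA.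
Qed.

(** The adjoint of a factorization [A ^t* = B ^t* *m D] puts [B] on the right of [A], where
    [mpinv B *m B] is absorbed. *)
Lemma mxrange_trC_sub_mpinv m n p (A : 'M[C]_(m, n)) (B : 'M[C]_(p, n)) :
  mxrange (A ^t*) `<=` mxrange (B ^t*) <-> A = A *m mpinv B *m B.
Proof.
split=> [/mxrange_subP[D h] | h].
  by rewrite -[A]trCmxK h trCmx_mul trCmxK -!mulmxA (mulmxA B) mulmx_mpinvK.
apply/mxrange_subP; exists ((A *m mpinv B) ^t*).
by rewrite -trCmx_mul -h.
Qed.

Lemma diamond_le_mpinv m n (A B : 'M[C]_(m, n)) :
  diamond_le A B <->
    (mpinv A = mpinv A *m B *m mpinv A /\
     A = B *m mpinv B *m A /\
     A = A *m mpinv B *m B).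
Proof.
split=> [[/mxrange_sub_mpinv hl /mxrange_trC_sub_mpinv hr /mpinv_outer h] //|].
by case=> h [hl hr]; split;
  [apply/mxrange_sub_mpinv | apply/mxrange_trC_sub_mpinv | apply/mpinv_outer].
Qed.

Lemma diamond_le_mpinv_fix m n (A B : 'M[C]_(m, n)) :
  diamond_le A B <->
    (mpinv A = mpinv A *m B *m mpinv A /\
     mpinv A = mpinv A *m B *m mpinv B /\
     mpinv A = mpinv B *m B *m mpinv A).
Proof.
(* The two range conditions move from [A] to [mpinv A] by taking for [P] the Hermitian projectors
   [B *m mpinv B] and [mpinv B *m B]. *)
have fixr := mpinv_fixr _ _ A _ (mulmx_mpinv_herm _ _ B).
have fixl := mpinv_fixl _ _ A _ (mpinv_mulmx_herm _ _ B).
rewrite !mulmxA in fixr fixl.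
by rewrite diamond_le_mpinv fixr fixl.
Qed.

End DiamondOrder.

Theorem theorem2p5 (R : realType) (m n : nat) (A B : 'M[R[i]]_(m, n)) :
  (diamond_le A B <->
    (mpinv A = mpinv A *m B *m mpinv A /\
     A = B *m mpinv B *m A /\
     A = A *m mpinv B *m B)) /\
  (diamond_le A B <->
    (mpinv A = mpinv A *m B *m mpinv A /\
     mpinv A = mpinv A *m B *m mpinv B /\
     mpinv A = mpinv B *m B *m mpinv A)).
Proof. by split; [apply: diamond_le_mpinv | apply: diamond_le_mpinv_fix]. Qed.
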